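(* Let $u\in L^3_{\mathrm{loc}}$ ($\mathbb R^3$-valued), $p\in L^{3/2}_{\mathrm{loc}}$ (scalar), $\ell>0$, and let $Q_r(z_0)$ be a cylinder on which $\Psi(z_0,r)$, $\Psi^\ell(z_0,r)$, $\Omega^\ell(z_0,r)$ are finite. Let $\varepsilon_0>0$ and $0<\eta<1/4$. If $\Psi(z_0,r)\ge\varepsilon_0$ and $\Omega^\ell(z_0,r)\le\eta\varepsilon_0$, then $$\Psi^\ell(z_0,r)\ge\left(\tfrac14-\eta\right)\varepsilon_0.$$ Equivalently, if $\Psi^\ell(z_0,r)<(1/4-\eta)\varepsilon_0$ while $\Psi(z_0,r)\ge\varepsilon_0$, then $\Omega^\ell(z_0,r)>\eta\varepsilon_0$.
   Context: For $z_0=(x_0,t_0)\in\mathbb R^3\times\mathbb R$ and $r>0$: $B_r(x_0)=\{x\in\mathbb R^3:|x-x_0|<r\}$ and $Q_r(z_0)=B_r(x_0)\times(t_0-r^2,t_0)$. For a function $f$, $(f)_{B_r(x_0)}(t)=|B_r|^{-1}\int_{B_r(x_0)}f(x,t)\,dx$ and $\mathsf P_{r,z_0}f(x,t)=f(x,t)-(f)_{B_r(x_0)}(t)$ for $(x,t)\in Q_r(z_0)$. Fix a nonnegative radial $\rho\in C_c^\infty(B_1(0))$ with $\int_{\mathbb R^3}\rho\,dx=1$. For $\ell>0$, $\rho_\ell(x)=\ell^{-3}\rho(x/\ell)$, $S_\ell f=\rho_\ell *_x f$ (convolution in space only), $U^\ell=S_\ell u$, $P^\ell=S_\ell p$. The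 fields are assumed to be defined on a spatially enlarged cylinder large enough for the convolution to be evaluated on $Q_r(z_0)$. Definitions: $\Psi(z_0,r)=r^{-2}\int_{Q_r(z_0)}(|u|^3+|\mathsf P_{r,z_0}p|^{3/2})\,dx\,dt$, $\Psi^\ell(z_0,r)=r^{-2}\int_{Q_r(z_0)}(|U^\ell|^3+|\mathsf P_{r,z_0}P^\ell|^{3/2})\,dx\,dt$, $\Omega^\ell(z_0,r)=r^{-2}\int_{Q_r(z_0)}(|u-U^\ell|^3+|\mathsf P_{r,z_0}(p-P^\ell)|^{3/2})\,dx\,dt$. *)

(* Defs.v *)
From HB Require Import structures.
From mathcomp Require Import all_boot all_order all_algebra.
From mathcomp Require Import all_classical all_reals all_analysis.

Set Implicit Arguments.
Unset Strict Implicit.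
Unset Printing Implicit Defensive.
Import Order.TTheory GRing.Theory Num.Theory.
Import numFieldNormedType.Exports.
Local Open Scope classical_set_scope.
Local Open Scope ring_scope.

(* Spatial points, and values of the velocity, are triples of reals; a
   space-time point (x, t) has type R3 R * R. *)
Notation R3 R := (R * R * R)%type.

(* The norm `|x| that the library puts on a product is the sup norm, hence the
   separate Euclidean norm. The two induce the same topology. *)
Definition enorm (R : realType) (x : R3 R) : R :=
  Num.sqrt (x.1.1 ^+ 2 + x.1.2 ^+ 2 + x.2 ^+ 2).

(* The library registers sigma-finiteness of m1 \x m2 as an instance, but only
   its instance for subprobabilities can be inferred. *)
Lemma sigma_finite_prod d1 d2 (T1 : measurableType d1) (T2 : measurableType d2)
    (R : realType) (m1 : {sigma_finite_measure set T1 -> \bar R})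
    (m2 : {sigma_finite_measure set T2 -> \bar R}) :
  sigma_finite setT (m1 \x m2)%E.
Proof.
have /sigma_finiteP[F [TF ndF Foo]] := sigma_finiteT m1.
have /sigma_finiteP[G [TG ndG Goo]] := sigma_finiteT m2.
exists (fun n => F n `*` G n).
  rewrite -setXTT TF TG predeqE => -[x y]; split.
    move=> [/= [n _ Fnx] [k _ Gky]]; exists (maxn n k) => //; split.
    - by move: x Fnx; exact/subsetPset/ndF/leq_maxl.
    - by move: y Gky; exact/subsetPset/ndG/leq_maxr.
  by move=> [n _ []/= ? ?]; split; exists n.
move=> k; have [? ?] := Foo k; have [? ?] := Goo k.
split; first exact: measurableX.
by rewrite product_measure1E// lte_mul_pinfty// ge0_fin_numE.
Qed.

Definition leb2 (R : realType) :=
  (@lebesgue_measure R \x @lebesgue_measure R)%E.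
HB.instance Definition _ (R : realType) := Measure.on (@leb2 R).
HB.instance Definition _ (R : realType) :=
  Measure_isSigmaFinite.Build _ _ _ (@leb2 R)
    (@sigma_finite_prod _ _ _ _ R lebesgue_measure lebesgue_measure).

Definition leb3 (R : realType) := (@leb2 R \x @lebesgue_measure R)%E.
HB.instance Definition _ (R : realType) := Measure.on (@leb3 R).
HB.instance Definition _ (R : realType) :=
  Measure_isSigmaFinite.Build _ _ _ (@leb3 R)
    (@sigma_finite_prod _ _ _ _ R (@leb2 R) lebesgue_measure).

Definition leb4 (R : realType) := (@leb3 R \x @lebesgue_measure R)%E.
HB.instance Definition _ (R : realType) := Measure.on (@leb4 R).
HB.instance Definition _ (R : realType) :=
  Measure_isSigmaFinite.Build _ _ _ (@leb4 R)
    (@sigma_finite_prod _ _ _ _ R (@leb3 R) lebesgue_measure).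

Definition eball (R : realType) (x0 : R3 R) (r : R) : set (R3 R) :=
  [set x | enorm (x - x0) < r].

(* B_s(x0) x (t0 - r^2, t0); the two radii differ only for the spatially
   enlarged cylinder. *)
Definition cylinder2 (R : realType) (z0 : R3 R * R) (s r : R) :
    set (R3 R * R) :=
  eball z0.1 s `*` `]z0.2 - r ^+ 2, z0.2[%classic.

Definition cylinder (R : realType) (z0 : R3 R * R) (r : R) :=
  cylinder2 z0 r r.

Section mollification.
Context (R : realType).

Definition iter_derive (vs : seq (R3 R)) (f : R3 R -> R) : R3 R -> R :=
  foldr (fun v g => fun x => 'D_v g x) f vs.

Definition Cinfty (f : R3 R -> R) : Prop :=
  forall vs : seq (R3 R),
    continuous (iter_derive vs f) /\
    forall x v, derivable (iter_derive vs f) x v.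

Definition csupp_in (U : set (R3 R)) (f : R3 R -> R) : Prop :=
  let S := closure [set x | f x != 0] in compact S /\ S `<=` U.

Definition radial (f : R3 R -> R) : Prop :=
  forall x y, enorm x = enorm y -> f x = f y.

Record radial_mollifier (rho : R3 R -> R) : Prop := {
  mollifier_ge0 : forall x, 0 <= rho x ;
  mollifier_radial : radial rho ;
  mollifier_smooth : Cinfty rho ;
  mollifier_supp : csupp_in (eball 0 1) rho ;
  mollifier_int : (\int[@leb3 R]_x (rho x)%:E = 1)%E
}.

Definition rescale (rho : R3 R -> R) (l : R) (x : R3 R) : R :=
  l ^- 3 * rho (l^-1 *: x).

(* S_l f (x, t) = int rho_l (x - y) f (y, t) dy. The values of f outside
   B_l(x) x {t} are irrelevant, so f may be an arbitrary total extension of a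
   function given on part of space-time only. *)
Definition smooth_x (rho : R3 R -> R) (l : R) (f : R3 R * R -> R)
    (z : R3 R * R) : R :=
  (\int[@leb3 R]_y (rescale rho l (z.1 - y) * f (y, z.2)))%R.

Definition smooth_x3 (rho : R3 R -> R) (l : R) (u : R3 R * R -> R3 R)
    (z : R3 R * R) : R3 R :=
  (smooth_x rho l (fun w => (u w).1.1) z,
   smooth_x rho l (fun w => (u w).1.2) z,
   smooth_x rho l (fun w => (u w).2) z).

End mollification.

Section quantities.
Context (R : realType).

Definition ball_mean (x0 : R3 R) (r : R) (f : R3 R * R -> R) (t : R) : R :=
  (fine (@leb3 R (eball x0 r)))^-1 *
  (\int[@leb3 R]_(x in eball x0 r) f (x, t))%R.

Definition osc (z0 : R3 R * R) (r : R) (f : R3 R * R -> R)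
    (z : R3 R * R) : R :=
  f z - ball_mean z0.1 r f z.2.

Definition Psi (u : R3 R * R -> R3 R) (p : R3 R * R -> R)
    (z0 : R3 R * R) (r : R) : \bar R :=
  ((r ^- 2)%:E *
   \int[@leb4 R]_(z in cylinder z0 r)
     (enorm (u z) ^+ 3 + `|osc z0 r p z| `^ (3 / 2))%:E)%E.

Definition Psil (rho : R3 R -> R) (l : R)
    (u : R3 R * R -> R3 R) (p : R3 R * R -> R) : R3 R * R -> R -> \bar R :=
  Psi (smooth_x3 rho l u) (smooth_x rho l p).

Definition Omegal (rho : R3 R -> R) (l : R)
    (u : R3 R * R -> R3 R) (p : R3 R * R -> R) : R3 R * R -> R -> \bar R :=
  Psi (fun z => u z - smooth_x3 rho l u z)
      (fun z => p z - smooth_x rho l p z).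

(* N is the norm of the values of f. *)
Definition Lloc d (V : measurableType d) (N : V -> R) (q : R)
    (D : set (R3 R * R)) (f : R3 R * R -> V) : Prop :=
  measurable_fun D f /\
  forall K : set (R3 R * R), compact K -> K `<=` D ->
    (\int[@leb4 R]_(z in K) (N (f z) `^ q)%:E < +oo)%E.

End quantities.

(* Main.v *)
Require Import Defs.
From HB Require Import structures.
From mathcomp Require Import all_boot all_order all_algebra.
From mathcomp Require Import all_classical all_reals all_analysis.
From mathcomp Require Import ring lra measurable_realfun.
Import Order.TTheory GRing.Theory Num.Theory.
Import numFieldNormedType.Exports.
Local Open Scope classical_set_scope.
Local Open Scope ring_scope.

Set Implicit Arguments.

(** Both assertions follow from Psi <= 4 (Psi^l + Omega^l), which is the
    pointwise bound |a + b|^q <= 4 (|a|^q + |b|^q) for q = 3 and q = 3/2,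
    integrated over the cylinder. The delicate point is that the ball mean of
    p is the sum of those of P^l and p - P^l only at times t at which p(., t)
    and P^l(., t) are integrable over the ball. By Tonelli's theorem the
    finiteness of Psi and Psi^l gives this for almost every t, because
    |p| <= 1 + |c| + |p - c|^(3/2) whatever the constant c is. The fields U^l
    and P^l are measurable on the cylinder as partial integrals of measurable
    functions. *)

(** * The Euclidean norm on triples *)

Section euclidean_norm.
Context {R : realType}.
Implicit Types x y : R3 R.

Lemma enorm_ge0 x : 0 <= enorm x.
Proof. exact: sqrtr_ge0. Qed.

(** Squaring reduces the claim to Cauchy-Schwarz, which follows from Lagrange's identity: the defect
    is the sum of the squares of the three 2x2 minors. *)
Lemma enorm_triangle x y : enorm (x + y) <= enorm x + enorm y.
Proof.
rewrite -ler_sqr ?nnegrE ?addr_ge0 ?enorm_ge0//.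
have sq z : enorm z ^+ 2 = z.1.1 ^+ 2 + z.1.2 ^+ 2 + z.2 ^+ 2.
  by rewrite sqr_sqrtr// !addr_ge0// sqr_ge0.
rewrite sqrrD !sq /=.
case: x y => [[a b] c] [[a' b'] c'] /=.
set N := enorm _; set M := enorm _.
suff : a * a' + b * b' + c * c' <= N * M by move=> h; nra.
rewrite (le_trans (ler_norm _))//.
rewrite -ler_sqr ?nnegrE ?normr_ge0 ?mulr_ge0 ?enorm_ge0//.
rewrite real_normK ?num_real// exprMn !sq /=.
have := sqr_ge0 (a * b' - b * a').
have := sqr_ge0 (a * c' - c * a').
have := sqr_ge0 (b * c' - c * b').
by nra.
Qed.

End euclidean_norm.

(** * Pointwise inequalities for the powers 3 and 3/2 *)

Section power_inequalities.
Context {R : realType}.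

(** The constant is the convexity constant 2^(3-1), attained at [a = b]; it is the source of the 1/4
    in the theorem. *)
Lemma cube_addr_le (a b : R) : 0 <= a -> 0 <= b ->
  (a + b) ^+ 3 <= 4 * (a ^+ 3 + b ^+ 3).
Proof.
move=> a0 b0.
rewrite -subr_ge0.
have -> : 4 * (a ^+ 3 + b ^+ 3) - (a + b) ^+ 3 = 3 * (a + b) * (a - b) ^+ 2 by ring.
by rewrite mulr_ge0 ?sqr_ge0// mulr_ge0 ?addr_ge0 ?ler0n.
Qed.

(** The sum is at most twice the larger term and 2^(3/2) <= 2^2. The constant is not sharp: it is
    chosen to agree with the one for cubes. *)
Lemma powR32_normD_le (a b : R) :
  `|a + b| `^ (3 / 2) <= 4 * (`|a| `^ (3 / 2) + `|b| `^ (3 / 2)).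
Proof.
have two_pow : (2 : R) `^ (3 / 2) <= 4.
  have -> : (4 : R) = 2 `^ 2 by rewrite powR_mulrn; lra.
  by apply: ler_powR; lra.
wlog ab : a b / `|a| <= `|b|.
  by move=> h; case: (leP `|a| `|b|) => [/h//|/ltW/h]; rewrite addrC [X in 4 * X]addrC.
apply: (@le_trans _ _ ((2 * `|b|) `^ (3 / 2))).
  apply: ge0_ler_powR; rewrite ?nnegrE ?mulr_ge0//.
  by rewrite (le_trans (ler_normD _ _))//; lra.
rewrite powRM// ler_pM ?powR_ge0//.
by rewrite lerDr powR_ge0.
Qed.

Lemma norm_le_powR32 (a : R) : `|a| <= 1 + `|a| `^ (3 / 2).
Proof.
have [a1|a1] := leP `|a| 1; first by rewrite ler_wpDr// powR_ge0.
rewrite ler_wpDl// -[leLHS]powRr1//.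
by apply: ler_powR; [exact: ltW|lra].
Qed.

End power_inequalities.

(** * Open sets are measurable in a space with a countable base of measurable sets *)

Section measurable_base.

(* The measurable sets M are a parameter because the library has no join of the
   topological and measurable structures. *)
Definition measurable_base (T : topologicalType) (M : set (set T)) :=
  exists (I : countType) (B : I -> set T), (forall i, M (B i)) /\
    forall x U, nbhs x U -> exists2 i, B i x & B i `<=` U.

Lemma measurable_base_prod (T1 T2 : topologicalType) M1 M2
    (M12 : set (set (T1 * T2))) :
  (forall A B, M1 A -> M2 B -> M12 (A `*` B)) ->
  measurable_base T1 M1 -> measurable_base T2 M2 -> measurable_base _ M12.
Proof.
move=> MX [I [B [MB Bx]]] [J [C [MC Cx]]].
exists (I * J)%type, (fun k => B k.1 `*` C k.2); split => [k|]; first exact: MX.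
move=> [x y] U [[P Q] /= [/Bx[i Bix BiP] /Cx[j Cjy CjQ]] PQU].
by exists (i, j) => // z [/BiP ? /CjQ ?]; exact: PQU.
Qed.

Lemma measurable_base_real (R : realType) :
  measurable_base R (measurable : set (set (measurableTypeR R))).
Proof.
exists (rat * rat)%type, (fun k => `]ratr k.1, ratr k.2[%classic).
split => [k|x U]; first exact: measurable_itv.
rewrite -nbhs_ballE => -[e /= e0 xeU].
have /rat_in_itvoo[a /[!in_itv]/= /andP[ax xa]] : x - e < x by rewrite ltrBlDr ltrDl.
have /rat_in_itvoo[b /[!in_itv]/= /andP[bx xb]] : x < x + e by rewrite ltrDl.
exists (a, b) => /=; first by rewrite in_itv/= xa.
move=> y; rewrite /= in_itv/= => /andP[ay yb]; apply: xeU.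
by rewrite /ball/= ltr_distlC; apply/andP; split; lra.
Qed.

Lemma measurable_base_open (T : topologicalType) (M : set (set T)) :
  M set0 -> (forall F : (set T)^nat, (forall n, M (F n)) -> M (\bigcup_n F n)) ->
  measurable_base T M -> open `<=` M.
Proof.
move=> M0 Mbigcup [I [B [MB Bx]]] U oU.
(* [U] is the union of the base sets contained in it. To run the union over the naturals, a number
   that codes no index, or codes a base set not inside [U], contributes the empty set. *)
have -> : U = \bigcup_n (if unpickle n is Some i then
    (if `[< B i `<=` U >] then B i else set0) else set0).
  apply/seteqP; split => [x Ux|x [n _]].
    have [i Bix BiU] := Bx x U (open_nbhs_nbhs (conj oU Ux)).
    by exists (pickle i) => //; rewrite pickleK asboolT.
  by case: unpickle => // i; case: asboolP => // BiU /BiU.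
by apply: Mbigcup => n; case: unpickle => // i; case: asboolP.
Qed.

End measurable_base.

(** * Partial integrals and slices on a product space *)

Section slices.
Context d1 d2 {T1 : measurableType d1} {T2 : measurableType d2} {R : realType}.
Variables (m1 : {sigma_finite_measure set T1 -> \bar R})
  (m2 : {sigma_finite_measure set T2 -> \bar R}).

(** Tonelli's theorem applies separately to the positive and the negative part. Where both integrals
    are infinite their difference takes a fixed default value, and [fine] sends infinities to 0;
    neither spoils measurability. *)
Lemma measurable_Rintegral1 (f : T1 * T2 -> R) :
  measurable_fun setT f ->
  measurable_fun setT (fun x => \int[m2]_y f (x, y)).
Proof.
move=> mf; pose F x : \bar R := (\int[m2]_y (f (x, y))%:E)%E.
suff mF : measurable_fun setT F.
  exact: (measurableT_comp (fine_measurable measurableT) mF).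
rewrite /F; under eq_fun do rewrite integralE.
have mf' : measurable_fun setT (EFin \o f) by exact/measurable_EFinP.
apply: emeasurable_funB.
  apply: eq_measurable_fun (measurable_fun_fubini_tonelli_F (m2 := m2) (EFin \o f)^\+%E
    (measurable_funepos mf') (funepos_ge0 _)) => z _.
  by apply: eq_integral => w _; rewrite !funeposE.
apply: eq_measurable_fun (measurable_fun_fubini_tonelli_F (m2 := m2) (EFin \o f)^\-%E
  (measurable_funeneg mf') (funeneg_ge0 _)) => z _.
by apply: eq_integral => w _; rewrite !funenegE.
Qed.

Lemma measurable_Rintegral2 (f : T1 * T2 -> R) :
  measurable_fun setT f ->
  measurable_fun setT (fun y => \int[m1]_x f (x, y)).
Proof.
move=> mf; pose F y : \bar R := (\int[m1]_x (f (x, y))%:E)%E.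
suff mF : measurable_fun setT F.
  exact: (measurableT_comp (fine_measurable measurableT) mF).
rewrite /F; under eq_fun do rewrite integralE.
have mf' : measurable_fun setT (EFin \o f) by exact/measurable_EFinP.
apply: emeasurable_funB.
  apply: eq_measurable_fun (measurable_fun_fubini_tonelli_G (m1 := m1) (EFin \o f)^\+%E
    (measurable_funepos mf') (funepos_ge0 _)) => z _.
  by apply: eq_integral => w _; rewrite !funeposE.
apply: eq_measurable_fun (measurable_fun_fubini_tonelli_G (m1 := m1) (EFin \o f)^\-%E
  (measurable_funeneg mf') (funeneg_ge0 _)) => z _.
by apply: eq_integral => w _; rewrite !funenegE.
Qed.

Variables (A : set T1) (I : set T2).
Hypotheses (mA : measurable A) (mI : measurable I).

(** Extension by zero carries the results on total functions over to functions measurable only on a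
    rectangle. *)
Lemma measurable_fun_restrict_setX (f : T1 * T2 -> R) :
  measurable_fun (A `*` I) f -> measurable_fun setT (f \_ (A `*` I)).
Proof.
move=> mf; apply/(measurable_restrict _ _ _).1 => //.
  exact: measurableX.
by rewrite setTI.
Qed.

Lemma measurable_slice (f : T1 * T2 -> R) t :
  measurable_fun (A `*` I) f -> I t -> measurable_fun A (fun x => f (x, t)).
Proof.
move=> /measurable_fun_restrict_setX mf It.
apply: (eq_measurable_fun (fun x => (f \_ (A `*` I)) (x, t))) => [x|].
  by move=> /set_mem Ax; rewrite patchE mem_set.
apply: measurable_funS (measurable_fun_pair1 t mf) => //.
Qed.

Lemma measurable_slice_Rintegral (f : T1 * T2 -> R) :
  measurable_fun (A `*` I) f ->
  measurable_fun I (fun t => \int[m1]_(x in A) f (x, t)).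
Proof.
move=> /measurable_fun_restrict_setX mf.
apply: (eq_measurable_fun (fun t => \int[m1]_x (f \_ (A `*` I)) (x, t))) => [t|].
  move=> /set_mem It; rewrite [RHS]Rintegral_mkcond; apply: eq_Rintegral => x _.
  rewrite !patchE; congr (if _ then _ else _).
  by apply/idP/idP => [/set_mem[/mem_set]|/set_mem Ax]//; exact/mem_set.
exact: measurable_funS (measurable_Rintegral2 mf).
Qed.

(** By Tonelli the 3/2 power of [|f - c|] is integrable over [A] at almost every time. There [|f|]
    is dominated by that power plus [1 + |c t|], which is constant in space and hence integrable on
    a set of finite measure. *)
Lemma ae_slice_integrable (f : T1 * T2 -> R) (c : T2 -> R) :
  (m1 A < +oo)%E ->
  measurable_fun (A `*` I) f -> measurable_fun I c ->
  (\int[m1 \x m2]_(z in A `*` I) (`|f z - c z.2| `^ (3 / 2))%:E < +oo)%E ->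
  {ae m2, forall t, I t -> m1.-integrable A (EFin \o (fun x => f (x, t)))}.
Proof.
move=> A_fin mf mc fin.
have mAI : measurable (A `*` I) by exact: measurableX.
pose g z : \bar R := (`|f z - c z.2| `^ (3 / 2))%:E.
have mg : measurable_fun (A `*` I) g.
  apply/measurable_EFinP; apply: (measurableT_comp (measurable_powR _)).
  apply: measurableT_comp => //; apply: measurable_funB => //.
  apply: (measurable_comp mI _ mc) => [_ [z [_ ?] <-]//|].
  exact: measurable_funS measurable_snd.
have : (m1 \x m2)%E.-integrable (A `*` I) g.
  apply/integrableP; split => //.
  by under eq_integral do rewrite gee0_abs ?lee_fin ?powR_ge0//.
move=> /(integrable_mkcond g mAI) /ae_integrable2.
apply: filterS => t ig It.
have mft := measurable_slice mf It.
apply: (le_integrable mA (g := fun x => (g (x, t) + (1 + `|c t|)%:E)%E)).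
- exact/measurable_EFinP.
- move=> x Ax; rewrite /g /= lee_fin [leRHS]ger0_norm ?addr_ge0 ?powR_ge0//.
  have := norm_le_powR32 (f (x, t) - c t).
  have := ler_normB (f (x, t)) (c t).
  have := ler_distD (c t) (f (x, t)) 0; rewrite !subr0.
  lra.
- apply: integrableD => //; last first.
    apply/integrableP; split; first exact: measurable_cst.
    by rewrite integral_cst// lte_mul_pinfty.
  apply/(integrable_mkcond _ mA).
  apply: eq_integrable ig => // x _.
  rewrite !patchE; congr (if _ then _ else _).
  by apply/idP/idP => [/set_mem[/mem_set]|/set_mem Ax]//; exact/mem_set.
Qed.

End slices.

(** * The integrated inequality for oscillations about slice means *)

(* The spaces are abstract because leb3 is a measure for a measurable structure
   that is convertible, but not syntactically equal, to the one inferred on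
   R3 R. *)
Section oscillation_bound.
Context d1 d2 {T1 : measurableType d1} {T2 : measurableType d2} {R : realType}.
Variables (m1 : {sigma_finite_measure set T1 -> \bar R})
  (m2 : {sigma_finite_measure set T2 -> \bar R}).
Variables (A : set T1) (I : set T2).
Hypotheses (mA : measurable A) (mI : measurable I) (A_fin : (m1 A < +oo)%E).

Let mAI : measurable (A `*` I).
Proof. exact: measurableX. Qed.

Definition slice_mean (f : T1 * T2 -> R) (t : T2) : R :=
  (fine (m1 A))^-1 * \int[m1]_(x in A) f (x, t).

Definition slice_osc (f : T1 * T2 -> R) (z : T1 * T2) : R :=
  f z - slice_mean f z.2.

Lemma measurable_slice_mean (f : T1 * T2 -> R) :
  measurable_fun (A `*` I) f -> measurable_fun I (slice_mean f).
Proof.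
by move=> mf; apply: measurable_funM => //; exact: measurable_slice_Rintegral.
Qed.

Lemma measurable_slice_osc (f : T1 * T2 -> R) :
  measurable_fun (A `*` I) f -> measurable_fun (A `*` I) (slice_osc f).
Proof.
move=> mf; apply: measurable_funB => //.
apply: (measurable_comp mI _ (measurable_slice_mean mf)) => [_ [z [_ ?] <-]//|].
exact: measurable_funS measurable_snd.
Qed.

(** The integrand of [Psi], with [a] in the role of the cubed speed: the velocity enters the
    argument only through a pointwise bound. *)
Definition osc_density (a p : T1 * T2 -> R) (z : T1 * T2) : R :=
  a z + `|slice_osc p z| `^ (3 / 2).

Definition osc_energy (a p : T1 * T2 -> R) : \bar R :=
  (\int[m1 \x m2]_(z in A `*` I) (osc_density a p z)%:E)%E.

Lemma osc_density_ge0 (a p : T1 * T2 -> R) z :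
  0 <= a z -> (0 <= (osc_density a p z)%:E)%E.
Proof. by move=> a0; rewrite lee_fin addr_ge0 ?powR_ge0. Qed.

Lemma measurable_osc_density (a p : T1 * T2 -> R) :
  measurable_fun (A `*` I) a -> measurable_fun (A `*` I) p ->
  measurable_fun (A `*` I) (EFin \o osc_density a p).
Proof.
move=> ma mp; apply/measurable_EFinP; apply: measurable_funD => //.
apply: (measurableT_comp (measurable_powR _)).
by apply: measurableT_comp => //; exact: measurable_slice_osc.
Qed.

(** There is no circularity in taking [slice_mean p] as the constant [c] before any slice is known
    to be integrable: it is a real number at every time, by default values if need be, and it is
    measurable in time. *)
Lemma ae_slice_integrable_osc (a p : T1 * T2 -> R) :
  (forall z, 0 <= a z) -> measurable_fun (A `*` I) a ->
  measurable_fun (A `*` I) p ->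
  (osc_energy a p < +oo)%E ->
  {ae m2, forall t, I t -> m1.-integrable A (EFin \o (fun x => p (x, t)))}.
Proof.
move=> a0 ma mp fin.
apply: (ae_slice_integrable m1 m2 mA mI A_fin mp (measurable_slice_mean mp)).
apply: le_lt_trans fin.
apply: ge0_le_integral; first by [].
- by move=> z _; rewrite lee_fin powR_ge0.
- apply: (eq_measurable_fun (EFin \o osc_density (cst 0) p)).
    by move=> z _; rewrite /= /osc_density add0r.
  exact: measurable_osc_density.
- exact: (measurable_osc_density ma mp).
- by move=> z _; rewrite lee_fin lerDr.
Qed.

Lemma slice_osc_split (p q : T1 * T2 -> R) x t :
  m1.-integrable A (EFin \o (fun x => p (x, t))) ->
  m1.-integrable A (EFin \o (fun x => q (x, t))) ->
  slice_osc p (x, t) =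
    slice_osc q (x, t) + slice_osc (fun z => p z - q z) (x, t).
Proof.
move=> ip iq; rewrite /slice_osc /slice_mean RintegralB//=.
by rewrite mulrBr; ring.
Qed.

(** Linearity first turns the right side into a single integral, so that it is enough to compare the
    integrands almost everywhere, namely at times when the slices of both [p] and [q] are
    integrable. *)
Lemma integral_osc_le (a b c p q : T1 * T2 -> R) :
  (forall z, 0 <= a z) -> (forall z, 0 <= b z) -> (forall z, 0 <= c z) ->
  (forall z, a z <= 4 * (b z + c z)) ->
  measurable_fun (A `*` I) a -> measurable_fun (A `*` I) b ->
  measurable_fun (A `*` I) c ->
  measurable_fun (A `*` I) p -> measurable_fun (A `*` I) q ->
  (osc_energy a p < +oo)%E -> (osc_energy b q < +oo)%E ->
  (osc_energy a p <=
    4%:E * (osc_energy b q + osc_energy c (fun z => p z - q z)%R))%E.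
Proof.
move=> a0 b0 c0 abc ma mb mc mp mq Eap Ebq.
have mpq : measurable_fun (A `*` I) (fun z => p z - q z).
  exact: measurable_funB.
have mbq := measurable_osc_density mb mq.
have mcpq := measurable_osc_density mc mpq.
pose r z := p z - q z; rewrite -/r in mcpq *.
rewrite /osc_energy -(ge0_integralD _ mAI
  (fun z _ => osc_density_ge0 b q z (b0 z)) mbq
  (fun z _ => osc_density_ge0 c r z (c0 z)) mcpq).
pose h z : \bar R := ((osc_density b q z)%:E + (osc_density c r z)%:E)%E.
have h0 z : (A `*` I) z -> (0 <= h z)%E.
  move=> _; apply: adde_ge0; first exact: (osc_density_ge0 b q z (b0 z)).
  exact: (osc_density_ge0 c r z (c0 z)).
have mh : measurable_fun (A `*` I) h by exact: (emeasurable_funD mbq mcpq).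
have four0 : (0 <= 4 :> R) by rewrite ler0n.
rewrite -(ge0_integralZl_EFin (m1 \x m2)%E mAI h0 mh four0).
apply: ae_ge0_le_integral; first by [].
- by move=> z _; exact: (osc_density_ge0 a p z (a0 z)).
- exact: (measurable_osc_density ma mp).
- by move=> z zAI; apply: mule_ge0; [rewrite lee_fin|exact: h0].
- exact: (measurable_funeM _ mh).
have [N [mN N0 subN]] : {ae m2, forall t, I t ->
    m1.-integrable A (EFin \o (fun x => p (x, t))) /\
    m1.-integrable A (EFin \o (fun x => q (x, t)))}.
  have ip := ae_slice_integrable_osc a0 ma mp Eap.
  have iq := ae_slice_integrable_osc b0 mb mq Ebq.
  by apply: filterS2 ip iq => t ip iq It; split; [exact: ip|exact: iq].
(* The exceptional set is all of space times the null set [N] of times. Even if space has infinite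
   measure the product is null, because infinity times 0 is 0 in [\bar R]. *)
exists (setT `*` N); split; first exact: measurableX.
  by rewrite [LHS](product_measure1E m1 m2 measurableT mN) N0 mule0.
move=> [x t] /= bad; split => //=; apply: subN => /= It; apply: bad => -[_ /= It'].
have {It} [ipt iqt] := It It'.
rewrite /h -EFinD -EFinM lee_fin /osc_density (slice_osc_split _ _ _ _ ipt iqt).
have := powR32_normD_le (slice_osc q (x, t)) (slice_osc r (x, t)).
move=> /(lerD (abc (x, t))); rewrite -mulrDr.
by rewrite [X in _ <= 4 * X]addrACA.
Qed.

End oscillation_bound.

(** For [x] in [A] the kernel vanishes off [B], so [f] may be replaced by its extension by zero from
    the rectangle. The integrand is then jointly measurable in all three variables, and its partial
    integral is measurable. *)
Lemma measurable_kernel_Rintegral d1 d2 (T1 : measurableType d1)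
    (T2 : measurableType d2) (R : realType)
    (m1 : {sigma_finite_measure set T1 -> \bar R})
    (A B : set T1) (I : set T2) (K : T1 * T1 -> R) (f : T1 * T2 -> R) :
  measurable A -> measurable B -> measurable I ->
  measurable_fun setT K -> measurable_fun (B `*` I) f ->
  (forall x y, A x -> ~ B y -> K (x, y) = 0) ->
  measurable_fun (A `*` I) (fun z => \int[m1]_y (K (z.1, y) * f (y, z.2))).
Proof.
move=> mA mB mI mK /(measurable_fun_restrict_setX mB mI) mf K0.
pose F (w : T1 * T2 * T1) := K (w.1.1, w.2) * (f \_ (B `*` I)) (w.2, w.1.2).
have mF : measurable_fun setT F.
  have m11 : measurable_fun setT (fun w : T1 * T2 * T1 => w.1.1).
    exact: measurableT_comp.
  have m12 : measurable_fun setT (fun w : T1 * T2 * T1 => w.1.2).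
    exact: measurableT_comp.
  apply: measurable_funM.
    apply: (measurableT_comp mK (g := fun w : T1 * T2 * T1 => (w.1.1, w.2))).
    exact: measurable_fun_pair.
  apply: (measurableT_comp mf (g := fun w : T1 * T2 * T1 => (w.2, w.1.2))).
  exact: measurable_fun_pair.
apply: (eq_measurable_fun (fun z => \int[m1]_y F (z, y))).
  move=> [x t] /set_mem[/= Ax It]; apply: eq_Rintegral => y _.
  rewrite /F /= patchE; case: ifPn => // /negP yB.
  by rewrite K0 ?mul0r// => By; apply: yB; exact: mem_set.
apply: measurable_funS (measurable_Rintegral1 m1 mF) => //.
Qed.

(** This turns continuity into measurability once the open sets of the source are known to be
    measurable. *)
Lemma measurable_fun_open_preimage d (T : measurableType d) (R : realType)
    (f : T -> R) :
  (forall U, open U -> measurable (f @^-1` U)) -> measurable_fun setT f.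
Proof.
move=> fU; apply: (measurability _ (RGenOpens.measurableE R)) => _ [_ [a [b ->] <-]].
by rewrite setTI; apply: fU; exact: interval_open.
Qed.

(** * Borel sets and Euclidean balls in three-dimensional space *)

Section lebesgue3.
Variable R : realType.
Local Notation meas3 := (measurable : set (set (R3 R))).

Let base3 : measurable_base (R3 R) meas3.
Proof.
have base1 : measurable_base R (measurable : set (set R)).
  exact: measurable_base_real.
apply: (measurable_base_prod _ _ _ base1) => [A B|]; first exact: measurableX.
by apply: (measurable_base_prod _ _ base1 base1) => A B; exact: measurableX.
Qed.

Lemma open_measurable3 (U : set (R3 R)) : open U -> measurable U.
Proof.
move=> oU; apply: (measurable_base_open (M := meas3)) oU => //.
by move=> F mF; exact: bigcupT_measurable.
Qed.

Lemma open_measurable4 (U : set (R3 R * R)) : open U -> measurable U.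
Proof.
move=> oU.
apply: (measurable_base_open (M := (measurable : set (set (R3 R * R))))) oU => //.
  by move=> F mF; exact: bigcupT_measurable.
apply: (measurable_base_prod _ (M2 := (measurable : set (set R))) _ base3
  (measurable_base_real R)) => A B.
exact: measurableX.
Qed.

Lemma open_measurable_prod3 (U : set (R3 R * R3 R)) : open U -> measurable U.
Proof.
move=> oU.
apply: (measurable_base_open (M := (measurable : set (set (R3 R * R3 R))))) oU => //.
  by move=> F mF; exact: bigcupT_measurable.
by apply: (measurable_base_prod _ _ base3 base3) => A B; exact: measurableX.
Qed.

Lemma continuous_enorm : continuous (@enorm R).
Proof.
move=> x; pose ss (y : R3 R) : R := y.1.1 ^+ 2 + y.1.2 ^+ 2 + y.2 ^+ 2.
suff css : {for x, continuous ss}.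
  exact: (continuous_comp css (@sqrt_continuous R (ss x))).
have c1 : {for x, continuous (fun y : R3 R => y.1.1)}.
  by apply: (@continuous_comp _ _ _ fst fst); exact: cvg_fst.
have c2 : {for x, continuous (fun y : R3 R => y.1.2)}.
  by apply: (@continuous_comp _ _ _ fst snd); [exact: cvg_fst|exact: cvg_snd].
have c3 : {for x, continuous (fun y : R3 R => y.2)} by exact: cvg_snd.
have sq (f : R3 R -> R) : {for x, continuous f} ->
    {for x, continuous (fun y => f y ^+ 2)}.
  by move=> cf; exact: (continuous_comp cf (@exprn_continuous R 2 (f x))).
by apply: continuousD; [apply: continuousD|]; exact: sq.
Qed.

Lemma measurable_enorm : measurable_fun setT (@enorm R).
Proof.
apply: measurable_fun_open_preimage => U oU; apply: open_measurable3.
by apply: open_comp oU => x _; exact: continuous_enorm.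
Qed.

Lemma measurable_eball (x0 : R3 R) (s : R) : measurable (eball x0 s).
Proof.
apply: open_measurable3.
have -> : eball x0 s = (fun x => enorm (x - x0)) @^-1` [set a | a < s] by [].
apply: open_comp; last exact: open_lt.
move=> x _; have cB : {for x, continuous (fun y : R3 R => y - x0)}.
  by apply: continuousB; [exact: cvg_id|exact: cvg_cst].
exact: (continuous_comp cB (@continuous_enorm (x - x0))).
Qed.

Lemma eball_sub_box (x0 : R3 R) (s : R) :
  eball x0 s `<=` `[x0.1.1 - s, x0.1.1 + s]%classic `*`
    `[x0.1.2 - s, x0.1.2 + s]%classic `*` `[x0.2 - s, x0.2 + s]%classic.
Proof.
move=> [[x y] z] /= /ltW xs.
have s0 : 0 <= s := le_trans (enorm_ge0 _) xs.
(* Each coordinate is bounded by the Euclidean norm. The bound is stated for the first summand; the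
   other two coordinates are reached by permuting the sum. *)
have coord (a b c : R) : 0 <= b -> 0 <= c -> Num.sqrt (a ^+ 2 + b + c) <= s ->
    `|a| <= s.
  move=> b0 c0; apply: le_trans; rewrite -sqrtr_sqr; apply: ler_wsqrtr.
  by rewrite -addrA lerDl addr_ge0.
have sq (a : R) : 0 <= a ^+ 2 by exact: sqr_ge0.
rewrite /enorm /= in xs.
have hx := coord _ _ _ (sq _) (sq _) xs.
have hy : `|y - x0.1.2| <= s.
  by apply: (coord _ _ _ (sq (x - x0.1.1)) (sq (z - x0.2))); rewrite [X in X + _]addrC.
have hz : `|z - x0.2| <= s.
  by apply: (coord _ _ _ (sq (x - x0.1.1)) (sq (y - x0.1.2))); rewrite -addrA addrC.
by rewrite !in_itv /= -!ler_distlC !(distrC _ x) !(distrC _ y) !(distrC _ z).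
Qed.

Lemma eball_fin (x0 : R3 R) (s : R) : (@leb3 R (eball x0 s) < +oo)%E.
Proof.
apply: (@le_lt_trans _ _ (@leb3 R (`[x0.1.1 - s, x0.1.1 + s]%classic `*`
    `[x0.1.2 - s, x0.1.2 + s]%classic `*` `[x0.2 - s, x0.2 + s]%classic))).
  apply: le_measure; rewrite ?inE.
  - exact: measurable_eball.
  - by apply: measurableX; [exact: measurableX|].
  - exact: eball_sub_box.
have itv_fin (a b : R) : (lebesgue_measure `[a, b]%classic \is a fin_num).
  by rewrite ge0_fin_numE// lebesgue_measure_itv /=; case: ifP; rewrite // -EFinD ltry.
pose X (a : R) := `[a - s, a + s]%classic.
have mX a : measurable (X a) by exact: measurable_itv.
have -> : @leb3 R (X x0.1.1 `*` X x0.1.2 `*` X x0.2) =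
    (lebesgue_measure (X x0.1.1) * lebesgue_measure (X x0.1.2) *
     lebesgue_measure (X x0.2))%E.
  apply: (etrans (product_measure1E (@leb2 R) lebesgue_measure
    (measurableX (mX _) (mX _)) (mX _))).
  congr (_ * _)%E.
  exact: (product_measure1E lebesgue_measure lebesgue_measure (mX _) (mX _)).
rewrite ltey_eq; apply/orP; left.
by apply: fin_numM; [apply: fin_numM|]; exact: itv_fin.
Qed.

End lebesgue3.

Lemma measurable_fun_pair_on d d1 d2 (T : measurableType d)
    (T1 : measurableType d1) (T2 : measurableType d2) (D : set T)
    (f : T -> T1) (g : T -> T2) :
  measurable_fun D f -> measurable_fun D g ->
  measurable_fun D (fun x => (f x, g x)).
Proof.
move=> mf mg mD.
apply: (measurability _ (measurable_prod_measurableType T1 T2)) => //.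
move=> _ [_ [A mA [B mB <-]] <-].
have -> : D `&` (fun x => (f x, g x)) @^-1` (A `*` B) =
    (D `&` f @^-1` A) `&` (D `&` g @^-1` B).
  by apply/seteqP; split => x /=; [move=> [? []]|move=> [[? ?] []]].
by apply: measurableI; [exact: mf|exact: mg].
Qed.

(** * Mollified fields, and the comparison of [Psi] for two pairs of fields *)

Section mollification.
Variable R : realType.

Lemma enormN (x : R3 R) : enorm (- x) = enorm x.
Proof. by rewrite /enorm /= !sqrrN. Qed.

Lemma enormZ (a : R) (x : R3 R) : enorm (a *: x) = `|a| * enorm x.
Proof.
rewrite /enorm -sqrtr_sqr -sqrtrM ?sqr_ge0//; congr Num.sqrt.
by rewrite /= !mulrDr -!exprMn.
Qed.

Lemma measurable_rescale_kernel (rho : R3 R -> R) (l : R) : continuous rho ->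
  measurable_fun setT (fun w : R3 R * R3 R => rescale rho l (w.1 - w.2)).
Proof.
move=> crho; apply: measurable_funM => //.
apply: measurable_fun_open_preimage => U oU; apply: open_measurable_prod3.
apply: open_comp oU => w _.
pose g (w : R3 R * R3 R) : R3 R := l^-1 *: (w.1 - w.2).
have cg : {for w, continuous g}.
  have cB : {for w, continuous (fun w : R3 R * R3 R => w.1 - w.2)}.
    by apply: continuousB; [exact: cvg_fst|exact: cvg_snd].
  exact: (continuous_comp cB (@scaler_continuous _ _ l^-1 (w.1 - w.2))).
exact: (continuous_comp cg (crho (g w))).
Qed.

(** This explains the enlarged radius [r + l]: a nonzero kernel forces [x] and [y] to be less than
    [l] apart, and the triangle inequality then puts [y] in the larger ball. *)
Lemma rescale_kernel_supp (rho : R3 R -> R) (l r : R) (x0 x y : R3 R) :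
  csupp_in (eball 0 1) rho -> 0 < l ->
  eball x0 r x -> ~ eball x0 (r + l) y -> rescale rho l (x - y) = 0.
Proof.
move=> [_ rho_supp] l0 xr yrl; rewrite /rescale.
have [->|rho0] := eqVneq (rho (l^-1 *: (x - y))) 0; first by rewrite mulr0.
have : eball 0 1 (l^-1 *: (x - y)) by apply: rho_supp; exact: subset_closure.
rewrite /eball /= subr0 enormZ gtr0_norm ?invr_gt0// mulrC ltr_pdivrMr// mul1r.
move=> xyl; exfalso; apply: yrl; rewrite /eball /=.
have -> : y - x0 = (x - x0) + - (x - y) by rewrite opprB [RHS]addrC addrA subrK.
by rewrite (le_lt_trans (enorm_triangle _ _))// enormN ltrD.
Qed.

Lemma measurable_smooth_x (rho : R3 R -> R) (l : R) (z0 : R3 R * R) (r : R)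
    (f : R3 R * R -> R) : radial_mollifier rho -> 0 < l ->
  measurable_fun (cylinder2 z0 (r + l) r) f ->
  measurable_fun (cylinder z0 r) (smooth_x rho l f).
Proof.
move=> hrho l0 mf.
(* The empty list of directions gives the continuity of [rho] itself. *)
have crho : continuous rho by have [] := mollifier_smooth hrho [::].
have := @measurable_kernel_Rintegral _ _ _ _ R (@leb3 R) (eball z0.1 r)
  (eball z0.1 (r + l)) `]z0.2 - r ^+ 2, z0.2[%classic
  (fun w => rescale rho l (w.1 - w.2)) f
  (measurable_eball _ _) (measurable_eball _ _) (measurable_itv _)
  (measurable_rescale_kernel l crho) mf.
apply => x y xr yrl.
exact: (@rescale_kernel_supp rho l r z0.1 x y (mollifier_supp hrho) l0 xr yrl).
Qed.

Let slab (z0 : R3 R * R) (r : R) : set R := `]z0.2 - r ^+ 2, z0.2[%classic.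

Let energy z0 r := osc_energy (@leb3 R) lebesgue_measure (eball z0.1 r) (slab z0 r).

Let measurable_fun_enorm3 (D : set (R3 R * R)) (u : R3 R * R -> R3 R) :
  measurable_fun D u -> measurable_fun D (fun z => enorm (u z) ^+ 3).
Proof.
by move=> mu; apply: measurable_funX; exact: (measurableT_comp (@measurable_enorm R)).
Qed.

Lemma measurable_funB3 (D : set (R3 R * R)) (u v : R3 R * R -> R3 R) :
  measurable_fun D u -> measurable_fun D v ->
  measurable_fun D (fun z => u z - v z).
Proof.
move=> mu mv.
have m1 (w : R3 R * R -> R3 R) :
    measurable_fun D w -> measurable_fun D (fun z => (w z).1 : R * R).
  by move=> mw; exact: (measurableT_comp measurable_fst mw).
have m11 (w : R3 R * R -> R3 R) :
    measurable_fun D w -> measurable_fun D (fun z => (w z).1.1 : R).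
  by move=> mw; exact: (measurableT_comp measurable_fst (m1 w mw)).
have m12 (w : R3 R * R -> R3 R) :
    measurable_fun D w -> measurable_fun D (fun z => (w z).1.2 : R).
  by move=> mw; exact: (measurableT_comp measurable_snd (m1 w mw)).
have m2 (w : R3 R * R -> R3 R) :
    measurable_fun D w -> measurable_fun D (fun z => (w z).2 : R).
  by move=> mw; exact: (measurableT_comp measurable_snd mw).
exact: (measurable_fun_pair_on
  (measurable_fun_pair_on (measurable_funB (m11 _ mu) (m11 _ mv))
    (measurable_funB (m12 _ mu) (m12 _ mv)))
  (measurable_funB (m2 _ mu) (m2 _ mv))).
Qed.

(** The abstract inequality is applied to the cubed norms of [u], [v] and [u - v], then multiplied
    by [r^-2]. The comparison fields [v] and [q] are arbitrary measurable ones, so no property of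
    convolution enters here. *)
Lemma Psi_le (u v : R3 R * R -> R3 R) (p q : R3 R * R -> R) z0 r : 0 < r ->
  measurable_fun (cylinder z0 r) u -> measurable_fun (cylinder z0 r) v ->
  measurable_fun (cylinder z0 r) p -> measurable_fun (cylinder z0 r) q ->
  (Psi u p z0 r < +oo)%E -> (Psi v q z0 r < +oo)%E ->
  (Psi u p z0 r <= 4%:E *
    (Psi v q z0 r + Psi (fun z => u z - v z)%R (fun z => p z - q z)%R z0 r))%E.
Proof.
move=> r0 mu mv mp mq.
pose e3 (w : R3 R * R -> R3 R) z : R := enorm (w z) ^+ 3.
have PsiE w f : Psi w f z0 r = ((r ^- 2)%:E * energy z0 r (e3 w) f)%E by [].
rewrite !PsiE => up_fin vq_fin.
have k0 : 0 < r ^- 2 by rewrite invr_gt0 exprn_gt0.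
have e30 w z : 0 <= e3 w z by rewrite exprn_ge0 ?enorm_ge0.
have E0 w f : (0 <= energy z0 r (e3 w) f)%E.
  by apply: integral_ge0 => z _; rewrite lee_fin addr_ge0 ?powR_ge0 ?e30.
(* The positive factor can be removed: an infinite energy would make the product infinite. *)
have E_fin w f : ((r ^- 2)%:E * energy z0 r (e3 w) f < +oo)%E ->
    (energy z0 r (e3 w) f < +oo)%E.
  move=> fin; rewrite ltey; apply/eqP => Eoo.
  by move: fin; rewrite Eoo gt0_muley ?ltxx ?lte_fin.
have split3 z : e3 u z <= 4 * (e3 v z + e3 (fun z => u z - v z) z).
  have uE : u z = v z + (u z - v z) by rewrite addrC subrK.
  apply: le_trans (cube_addr_le _ _ (enorm_ge0 _) (enorm_ge0 _)).
  rewrite {1}/e3 lerXn2r ?nnegrE ?addr_ge0 ?enorm_ge0//.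
  by rewrite {1}uE enorm_triangle.
have le4 : (energy z0 r (e3 u) p <= 4%:E * (energy z0 r (e3 v) q +
    energy z0 r (e3 (fun z => u z - v z)%R) (fun z => p z - q z)%R))%E.
  exact: (@integral_osc_le _ _ _ _ R (@leb3 R) lebesgue_measure (eball z0.1 r)
    (slab z0 r) (@measurable_eball R z0.1 r) (measurable_itv _) (@eball_fin R z0.1 r)
    (e3 u) (e3 v) (e3 (fun z => u z - v z)) p q (e30 u) (e30 v) (e30 _) split3
    (measurable_fun_enorm3 mu) (measurable_fun_enorm3 mv)
    (measurable_fun_enorm3 (measurable_funB3 mu mv)) mp mq
    (E_fin _ _ up_fin) (E_fin _ _ vq_fin)).
rewrite -(ge0_muleDr _ (E0 v q) (E0 (fun z => u z - v z) (fun z => p z - q z))).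
rewrite muleCA lee_pmul2l ?lte_fin//.
Qed.

End mollification.

Lemma measurable_smooth_x3 (R : realType) (rho : R3 R -> R) (l : R)
    (z0 : R3 R * R) (r : R) (u : R3 R * R -> R3 R) :
  radial_mollifier rho -> 0 < l ->
  measurable_fun (cylinder2 z0 (r + l) r) u ->
  measurable_fun (cylinder z0 r) (smooth_x3 rho l u).
Proof.
move=> hrho l0 mu.
have mu1 := measurableT_comp measurable_fst mu.
have m11 := measurableT_comp measurable_fst mu1.
have m12 := measurableT_comp measurable_snd mu1.
have m2 := measurableT_comp measurable_snd mu.
have h1 := measurable_smooth_x _ hrho l0 m11.
have h2 := measurable_smooth_x _ hrho l0 m12.
have h3 := measurable_smooth_x _ hrho l0 m2.
exact: (measurable_fun_pair_on (measurable_fun_pair_on h1 h2) h3).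
Qed.

(** * The two assertions for the mollified fields *)

Unset Implicit Arguments.

Theorem corollary3p2 (R : realType) (rho : R3 R -> R)
  (hrho : radial_mollifier rho)
  (l : R) (hl : 0 < l)
  (z0 : R3 R * R) (r : R) (hr : 0 < r)
  (D : set (R3 R * R)) (hD : open D) (hQD : cylinder2 z0 (r + l) r `<=` D)
  (u : R3 R * R -> R3 R) (hu : Lloc (@enorm R) 3 D u)
  (p : R3 R * R -> R) (hp : Lloc (fun a : R => `|a|) (3 / 2) D p)
  (hPsi : (Psi u p z0 r < +oo)%E)
  (hPsil : (Psil rho l u p z0 r < +oo)%E)
  (hOmegal : (Omegal rho l u p z0 r < +oo)%E)
  (eps0 : R) (heps0 : 0 < eps0)
  (eta : R) (heta0 : 0 < eta) (heta : eta < 1 / 4) :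
  ((eps0%:E <= Psi u p z0 r)%E ->
   (Omegal rho l u p z0 r <= (eta * eps0)%:E)%E ->
   (((1 / 4 - eta) * eps0)%:E <= Psil rho l u p z0 r)%E)
  /\
  ((Psil rho l u p z0 r < ((1 / 4 - eta) * eps0)%:E)%E ->
   (eps0%:E <= Psi u p z0 r)%E ->
   ((eta * eps0)%:E < Omegal rho l u p z0 r)%E).
Proof.
have mB s : measurable (cylinder2 z0 s r).
  by apply: measurableX; [exact: measurable_eball|exact: measurable_itv].
have BQ : cylinder z0 r `<=` cylinder2 z0 (r + l) r.
  move=> z [zr zI]; split=> //; apply: lt_trans zr _; exact: ltr_pwDr.
have mD := open_measurable4 hD.
have mul := measurable_funS mD hQD hu.1.
have mpl := measurable_funS mD hQD hp.1.
have mu := measurable_funS (mB _) BQ mul.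
have mp := measurable_funS (mB _) BQ mpl.
have le4 := Psi_le hr mu (measurable_smooth_x3 _ hrho hl mul) mp
  (measurable_smooth_x _ hrho hl mpl) hPsi hPsil.
have {}le4 : (Psi u p z0 r <=
  4%:E * (Psil rho l u p z0 r + Omegal rho l u p z0 r))%E by exact: le4.
have Psi_ge0 v q : (0 <= Psi v q z0 r)%E.
  apply: mule_ge0; first by rewrite lee_fin invr_ge0 exprn_ge0 ?ltW.
  apply: integral_ge0 => z _.
  by rewrite lee_fin addr_ge0 ?powR_ge0 ?exprn_ge0 ?enorm_ge0.
have Psil0 : (0 <= Psil rho l u p z0 r)%E by exact: Psi_ge0.
have Omegal0 : (0 <= Omegal rho l u p z0 r)%E by exact: Psi_ge0.
(* The second assertion is the contrapositive of the first in the pair of bounds on [Psil] and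
   [Omegal]. *)
suff main : (eps0%:E <= Psi u p z0 r)%E ->
    (Omegal rho l u p z0 r <= (eta * eps0)%:E)%E ->
    (((1 / 4 - eta) * eps0)%:E <= Psil rho l u p z0 r)%E.
  split; first exact: main.
  move=> Psil_lt Psi_ge; rewrite ltNge; apply/negP => /(main Psi_ge) Psil_ge.
  by have := le_lt_trans Psil_ge Psil_lt; rewrite ltxx.
clear -hPsil hOmegal le4 Psil0 Omegal0.
move: hPsil hOmegal Psil0 Omegal0 le4.
(* Finiteness and nonnegativity rule out both infinities. What remains is real arithmetic:
   [eps0 <= 4 * (a + b)] and [b <= eta * eps0] give [a >= eps0 / 4 - eta * eps0]. *)
case: (Psil rho l u p z0 r) => [a| |] //; case: (Omegal rho l u p z0 r) => [b| |] //.
rewrite -EFinD -EFinM => _ _ _ _ le4 /le_trans/(_ le4).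
rewrite !lee_fin => eps_le b_le; lra.
Qed.
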